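(* Let $\Omega$ be an atomless Borel probability space with measure $\nu$ and let $W:\Omega^2\to[0,1]$ be a graphon. If every extreme point $\mathfrak c$ of the set $\mathrm{FCOV}(W)$ of all fractional vertex covers of $W$ is integral (i.e. $\mathfrak c(x)\in\{0,1\}$ for almost every $x\in\Omega$), then $W$ is bipartite.
   Context: A graphon is a symmetric measurable function $W:\Omega^2\to[0,1]$. Write $\operatorname{supp} W=\{(x,y): W(x,y)>0\}$. A graphon $W$ is bipartite if there is a partition $\Omega=\Omega_1\sqcup\Omega_2$ into measurable sets such that for $i=1,2$, $W=0$ almost everywhere on $\Omega_i\times\Omega_i$. A fractional vertex cover of $W$ is a function $\mathfrak c\in L^\infty(\Omega)$ such that $0\le\mathfrak c\le 1$ almost everywhere and the set $\operatorname{supp}W\setminus\{(x,y):\mathfrak c(x)+\mathfrak c(y)\ge 1\}$ has $\nu^{\otimes 2}$-measure $0$. $\mathrm{FCOV}(W)\subseteq L^\infty(\Omega)$ is the (convex) set of all fractional vertex covers of $W$. A point $x$ of a convex set $X$ is extreme if the only pair $x',x''\in X$ with $x=\frac12(x'+x'')$ is $x'=x''=x$. *)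

(* Defs.v *)
From HB Require Import structures.
From mathcomp Require Import all_boot all_order all_algebra.
From mathcomp Require Import all_classical all_reals all_analysis.

Set Implicit Arguments.
Unset Strict Implicit.
Unset Printing Implicit Defensive.

Import Order.TTheory GRing.Theory Num.Theory.
Import numFieldNormedType.Exports.

Local Open Scope classical_set_scope.
Local Open Scope ring_scope.

(* The measurable space is isomorphic to a Polish space with its Borel
   sigma-algebra.  A Hausdorff complete pseudometric space is a complete metric
   space, and for metric spaces second countable means separable. *)
Definition standard_borel (R : realType) d (T : measurableType d) : Prop :=
  exists (P : completePseudoMetricType R) (f : T -> P),
    [/\ hausdorff_space P, @second_countable P, bijective f &
        forall A : set T,
          measurable A <-> exists2 B : set P, <<s open >> B & A = f @^-1` B].

Definition atomless (R : realType) d (T : measurableType d)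
    (mu : {measure set T -> \bar R}) : Prop :=
  forall A : set T, measurable A -> (0 < mu A)%E ->
    exists B : set T, [/\ measurable B, B `<=` A & (0 < mu B < mu A)%E].

Section Graphon.
Context (R : realType) d (T : measurableType d) (nu : probability T R).
Implicit Type W : T * T -> R.

Definition is_graphon W : Prop :=
  [/\ measurable_fun [set: T * T] W,
      forall x y, W (x, y) = W (y, x) &
      forall p, 0 <= W p <= 1].

Definition gsupp W : set (T * T) := [set p | 0 < W p].

Definition bipartite W : Prop :=
  exists T1 T2 : set T,
    [/\ measurable T1 /\ measurable T2, T1 `|` T2 = setT, T1 `&` T2 = set0,
        W = cst 0 %[ae (nu \x nu)%E in T1 `*` T1] &
        W = cst 0 %[ae (nu \x nu)%E in T2 `*` T2]].

(* Elements of L^oo(nu) are given by representatives: [Linfty] consists of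
   functions, and equality in L^oo(nu) is equality [%[ae nu]]. *)
Definition Linfty := LfunType nu (leey 1).

Definition FCOV W : set Linfty :=
  [set c : Linfty | {ae nu, forall x, 0 <= c x <= 1} /\
           (nu \x nu)%E (gsupp W `\` [set p | 1 <= c p.1 + c p.2]) = 0%E].

Definition extreme_point (X : set Linfty) (c : Linfty) : Prop :=
  X c /\ forall c1 c2 : Linfty, X c1 -> X c2 ->
    c = (2^-1 *: (c1 + c2) : Linfty) %[ae nu] ->
    c1 = c %[ae nu] /\ c2 = c %[ae nu].

Definition integral_cover (c : Linfty) : Prop :=
  {ae nu, forall x, c x = 0 \/ c x = 1}.

End Graphon.

Arguments FCOV [R d T] nu W.

(* Main.v *)
Require Import Defs.
From mathcomp Require Import all_boot all_order all_algebra.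
From mathcomp Require Import all_classical all_reals all_analysis measurable_realfun ess_sup_inf.
From mathcomp Require Import lra.

(* Call a pair (A, B) of disjoint measurable sets matched if almost every edge
   of W meeting A or B joins A to B.  By exhaustion there is a matched pair with
   A `|` B of maximal measure; let Z be the complement of A `|` B.  The function
   c equal to 0 on A, 1 on B and 1/2 on Z is a fractional vertex cover.  It is
   extreme: if c = (c1 + c2) / 2, then c1 = c2 = c on A and B, while on Z the
   covering constraints for c1 and c2 add up to equalities, so that
   ({c1 < 1/2}, {c1 > 1/2}) restricted to Z is again matched, hence null by
   maximality.  Integrality of c then forces Z to be null, and (A, B `|` Z) is
   a bipartition. *)

Set Implicit Arguments.
Unset Strict Implicit.
Unset Printing Implicit Defensive.

Import Order.TTheory GRing.Theory Num.Theory.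

Local Open Scope classical_set_scope.
Local Open Scope ring_scope.

(** The union [M] of members of [F] whose measures approach the supremum [s] attains it. For [A] in
    [F] the union of [M] and [A] is again in [F], so [A] cannot add mass to [M]. *)
Lemma measure_exhaustion d (T : measurableType d) (R : realType)
    (mu : {finite_measure set T -> \bar R}) (F : set (set T)) :
  F `<=` measurable -> F set0 ->
  (forall S : (set T)^nat, (forall n, F (S n)) -> F (\bigcup_n S n)) ->
  exists2 M, F M & forall A, F A -> mu (A `\` M) = 0%E.
Proof.
move=> Fm F0 Fbigcup; pose s := ereal_sup [set mu A | A in F].
have les A : F A -> (mu A <= s)%E.
  by move=> FA; apply: ereal_sup_ubound; exists A.
have s_fin : s \is a fin_num.
  rewrite ge0_fin_numE; last by rewrite -(measure0 mu) les.
  apply: (@le_lt_trans _ _ (mu setT)); last by rewrite ltey_eq fin_num_measure.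
  apply: ge_ereal_sup => _ [A FA <-].
  by apply: le_measure; rewrite ?inE//; exact: Fm.
have /choice[S FS] n : exists A, F A /\ (s - n.+1%:R^-1%:E < mu A)%E.
  have /ub_ereal_sup_adherent : 0 < n.+1%:R^-1 :> R by rewrite invr_gt0.
  by move=> /(_ _ s_fin)[_ [A FA <-] ltA]; exists A.
have FM : F (\bigcup_n S n) by apply: Fbigcup => n; exact: (FS n).1.
exists (\bigcup_n S n) => // A FA.
set M := \bigcup_n S n in FM *.
have mM := Fm _ FM; have mA := Fm _ FA.
have sM : (s <= mu M)%E.
  apply/lee_addgt0Pr => e e0.
  have [n ne] : exists n : nat, n.+1%:R^-1 < e.
    by have [n _ /(_ n (leqnn n))] := near_infty_natSinv_lt (PosNum e0); exists n.
  have [FSn] := FS n; rewrite lteBlDr// => /ltW/le_trans; apply.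
  apply: leeD; last by rewrite lee_fin ltW.
  apply: le_measure; rewrite ?inE//; first exact: Fm.
  exact: bigcup_sup.
(* The set is the union of the sequence [M], [A], [set0], [set0], ..., hence the need for [F set0].
   Finiteness of [mu M] then allows cancelling it. *)
have : (mu (M `|` A `\` M) <= mu M)%E.
  rewrite setDE setUIr setUCr setIT (le_trans _ sM)// les// -bigcup2E.
  by apply: Fbigcup => -[|[|n]].
rewrite measureU//; [|exact: measurableD|by rewrite setDE setICA setICr setI0].
rewrite -[leRHS]adde0 leeD2lE ?fin_num_measure// measure_le0 => /eqP//.
Qed.

Lemma measurable_set_ler d (T : measurableType d) (R : realType)
    (f g : T -> R) : measurable_fun setT f -> measurable_fun setT g ->
  measurable [set x | f x <= g x].
Proof.
by move=> mf mg; rewrite -[X in measurable X]setTI; exact: measurable_fun_le.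
Qed.

Lemma measurable_set_ltr d (T : measurableType d) (R : realType)
    (f g : T -> R) : measurable_fun setT f -> measurable_fun setT g ->
  measurable [set x | f x < g x].
Proof.
move=> mf mg; rewrite (_ : [set _ | _] = ~` [set x | g x <= f x]).
  by apply: measurableC; exact: measurable_set_ler.
by apply/seteqP; split => x /=; rewrite ltNge => /negP.
Qed.

Section graphon.
Context d (T : measurableType d) (R : realType) (nu : probability T R).
Context (W : T * T -> R).

Lemma ae_prod (P : T -> Prop) : {ae nu, forall x, P x} ->
  {ae (nu \x nu)%E, forall p, P p.1 /\ P p.2}.
Proof.
move=> [N [mN N0 PN]]; exists (N `*` setT `|` setT `*` N); split.
- by apply: measurableU; exact: measurableX.
- apply/negligibleP; first by apply: measurableU; exact: measurableX.
  apply: negligibleU; (apply/negligibleP; first exact: measurableX).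
    transitivity (nu N * nu setT)%E; last by rewrite N0 mul0e.
    exact: product_measure1E.
  transitivity (nu setT * nu N)%E; last by rewrite N0 mule0.
  exact: product_measure1E.
- by move=> p /= /not_andP[] /PN Np; [left|right].
Qed.

(** Turns the null-set condition into an almost-everywhere one, which filter reasoning can combine.
    The two agree because the set of uncovered edges is measurable. *)
Lemma FCOVP (c : Linfty nu) : measurable_fun [set: T * T] W ->
  FCOV nu W c <-> {ae nu, forall x, 0 <= c x <= 1} /\
    {ae (nu \x nu)%E, forall p, 0 < W p -> 1 <= c p.1 + c p.2}.
Proof.
move=> mW.
have mc : measurable_fun [set: T] c by [].
set E := gsupp W `\` [set p | 1 <= c p.1 + c p.2].
have mE : measurable E.
  apply: measurableD; first exact: measurable_set_ltr.
  apply: measurable_set_ler => //.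
  by apply: measurable_funD; exact: measurableT_comp.
have EE : E = ~` [set p | 0 < W p -> 1 <= c p.1 + c p.2].
  by apply/seteqP; split => p /= /not_implyP.
split=> -[c01 Wc]; split => //.
  by rewrite /prop_near1 /nbhs/= /almost_everywhere -EE; exact/negligibleP.
by apply/negligibleP => //; rewrite -/E EE.
Qed.

Lemma Linfty_of_bounded (f : T -> R) : measurable_fun [set: T] f ->
  (forall x, 0 <= f x <= 1) -> exists c : Linfty nu, c = f :> (T -> R).
Proof.
move=> mf f01.
have fL : f \in Lfun nu +oo%E.
  apply/andP; split; rewrite inE//=.
  (* The norm is a conditional whose default branch is trivially finite; the other is the essential
     supremum of the absolute value of [f], at most 1. *)
  rewrite /finite_norm unlock; case: ifPn => // _.
  apply: (@le_lt_trans _ _ 1%:E); last exact: ltry.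
  apply/ess_supP; apply: aeW => x /=.
  by have /andP[f0 f1] := f01 x; rewrite lee_fin ger0_norm.
by exists (Lfun_Sub (leey 1) fL).
Qed.

(* Almost every edge meeting A `|` B joins A to B; this is stated symmetrically
   in both coordinates so that the symmetry of W is not needed. *)
Definition matched (A B : set T) : Prop :=
  [/\ measurable A, measurable B, A `&` B = set0 &
      {ae (nu \x nu)%E, forall p, 0 < W p ->
        (A p.1 <-> B p.2) /\ (B p.1 <-> A p.2)}].

Lemma matched0 : matched set0 set0.
Proof. by split; rewrite ?setI0//; apply: aeW => p. Qed.

(* Cutting A n and B n down to the part of A n `|` B n not covered by earlier
   pairs preserves matching, since almost no edge leaves A k `|` B k. *)
Lemma matched_bigcup (A B : (set T)^nat) : (forall n, matched (A n) (B n)) ->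
  exists A' B', matched A' B' /\ A' `|` B' = \bigcup_n (A n `|` B n).
Proof.
move=> mAB; pose D := seqDU (fun n => A n `|` B n).
have mA n : measurable (A n) by have [] := mAB n.
have mB n : measurable (B n) by have [] := mAB n.
have mD n : measurable (D n).
  apply: measurableD; first exact: measurableU.
  by apply: bigsetU_measurable => k _; exact: measurableU.
exists (\bigcup_n (A n `&` D n)), (\bigcup_n (B n `&` D n)); split; last first.
  rewrite -bigcupU [RHS]seqDU_bigcup_eq; apply: eq_bigcup => // n _.
  by rewrite -setIUl; apply/setIidPr; exact: subset_seqDU.
split.
- by apply: bigcup_measurable => n _; exact: measurableI.
- by apply: bigcup_measurable => n _; exact: measurableI.
- rewrite -subset0 => x [[n _ [Anx Dnx]] [m _ [Bmx Dmx]]].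
  have nm : n = m.
    by apply: (trivIset_seqDU (fun n => A n `|` B n)) => //; exists x.
  by have [_ _ <- _] := mAB n; split=> //; rewrite nm.
- have : {ae (nu \x nu)%E, forall p, forall n, 0 < W p ->
      (A n p.1 <-> B n p.2) /\ (B n p.1 <-> A n p.2)}.
    by apply: ae_foralln => n; have [] := mAB n.
  apply: filterS => p Wp W0.
  have DD n : D n p.1 <-> D n p.2.
    have -> : D n = (A n `|` B n) `\` \bigcup_(k < n) (A k `|` B k).
      by rewrite bigcup_mkord.
    split => -[ABn nAB]; split.
    + by have [AB BA] := Wp n W0; case: ABn => [/AB|/BA]; [right|left].
    + move=> [k kn ABk]; apply: nAB; exists k => //.
      by have [AB BA] := Wp k W0; case: ABk => [/BA|/AB]; [right|left].
    + by have [AB BA] := Wp n W0; case: ABn => [/BA|/AB]; [right|left].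
    + move=> [k kn ABk]; apply: nAB; exists k => //.
      by have [AB BA] := Wp k W0; case: ABk => [/AB|/BA]; [right|left].
  split; split=> -[n _ [ABn Dn]]; exists n => //; have [AB BA] := Wp n W0;
    by split; first [exact/AB | exact/BA | exact/DD].
Qed.

(** Exhaustion is applied to the unions of matched pairs, a family closed under countable unions by
    [matched_bigcup], although the pairs themselves cannot be united componentwise. *)
Lemma maximal_matched : exists A B, matched A B /\
  forall A' B', matched A' B' -> nu ((A' `|` B') `\` (A `|` B)) = 0%E.
Proof.
pose F : set (set T) := [set S | exists A B, matched A B /\ A `|` B = S].
have [|||M [A [B [mAB <-]]] Mmax] := @measure_exhaustion _ _ _ nu F.
- by move=> _ [A [B [[mA mB _ _] <-]]]; exact: measurableU.
- by exists set0, set0; rewrite setU0; split => //; exact: matched0.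
- move=> S /(_ _)/cid-/all_sig[A] /(_ _)/cid-/all_sig[B] mAB.
  have [A' [B' [mAB' AB'E]]] := matched_bigcup (fun n => (mAB n).1).
  exists A', B'; split=> //; rewrite AB'E; apply: eq_bigcup => // n _.
  exact: (mAB n).2.
- by exists A, B; split=> // A' B' mAB'; apply: Mmax; exists A', B'.
Qed.

End graphon.

Theorem theorem15 (R : realType) (d : measure_display) (T : measurableType d)
    (nu : probability T R) (W : T * T -> R)
    (hT : standard_borel R T) (hnu : atomless nu) (hW : is_graphon W)
    (hext : forall c : Linfty nu,
        extreme_point (FCOV nu W) c -> integral_cover c) :
  bipartite nu W.
Proof.
have [mW _ W01] := hW.
have [A [B [[mA mB AB0 ABW] ABmax]]] := maximal_matched nu W.
pose Z := ~` (A `|` B).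
have mZ : measurable Z by apply: measurableC; exact: measurableU.
have AnB x : A x -> ~ B x by move=> Ax Bx; rewrite -[False]/(set0 x) -AB0.
have cases x : [\/ A x, B x | Z x].
  have [Ax|nAx] := pselect (A x); first by constructor 1.
  have [Bx|nBx] := pselect (B x); first by constructor 2.
  by constructor 3 => -[].
pose f x : R := \1_B x + 2^-1 * \1_Z x.
have fA x : A x -> f x = 0.
  move=> Ax; rewrite /f !indicE !memNset ?mulr0 ?addr0//; last exact: AnB.
  by apply; left.
have fB x : B x -> f x = 1.
  move=> Bx; rewrite /f !indicE mem_set// memNset ?mulr0 ?addr0//.
  by apply; right.
have fZ x : Z x -> f x = 2^-1.
  move=> Zx; rewrite /f !indicE memNset ?mem_set ?mulr1 ?add0r//.
  by move=> Bx; apply: Zx; right.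
have mf : measurable_fun setT f.
  by apply: measurable_funD => //; apply: measurable_funM.
have f01 x : 0 <= f x <= 1.
  by have [/fA|/fB|/fZ] := cases x => ->; lra.
have [c cf] := Linfty_of_bounded nu mf f01.
have edgeZ p : (A p.1 <-> B p.2) /\ (B p.1 <-> A p.2) -> Z p.1 <-> Z p.2.
  move=> [AB BA]; split=> nZ [?|?]; apply: nZ.
  - by right; apply/BA.
  - by left; apply/AB.
  - by right; apply/AB.
  - by left; apply/BA.
have cZ : integral_cover c.
  apply: hext; split.
    apply/FCOVP => //; split; first by apply: aeW => x; rewrite cf.
    apply: filterS ABW => p /[apply] pAB; have [AB BA] := pAB.
    rewrite cf; have [Ap|Bp|Zp] := cases p.1.
    + by rewrite fA// fB; [lra|apply/AB].
    + by rewrite fB// fA; [lra|apply/BA].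
    + by rewrite !fZ//; [lra|apply/(edgeZ p)].
  move=> c1 c2 /(FCOVP c1 mW)[c1_01 Wc1] /(FCOVP c2 mW)[c2_01 Wc2] cE.
  pose P x := [/\ 0 <= c1 x <= 1, 0 <= c2 x <= 1 & f x = 2^-1 * (c1 x + c2 x)].
  have aeP : {ae nu, forall x, P x}.
    apply: filterS3 c1_01 c2_01 cE => x c1x c2x /(_ I) cx.
    by split => //; rewrite -cf cx.
  pose A' := Z `&` [set x | c1 x < 2^-1].
  pose B' := Z `&` [set x | 2^-1 < c1 x].
  have mAB' : matched nu W A' B'.
    split.
    - by apply: measurableI => //; exact: measurable_set_ltr.
    - by apply: measurableI => //; exact: measurable_set_ltr.
    - rewrite -subset0 => x [[_ /= c1lt] [_ /= c1gt]].
      by move: (lt_trans c1lt c1gt); rewrite ltxx.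
    - near=> p => Wp.
      have ZZ : Z p.1 <-> Z p.2 by apply: edgeZ; move: Wp; near: p.
      have Wc1p : 1 <= c1 p.1 + c1 p.2 by move: Wp; near: p.
      have Wc2p : 1 <= c2 p.1 + c2 p.2 by move: Wp; near: p.
      have [P1 P2] : P p.1 /\ P p.2 by near: p; exact: ae_prod.
      move: P1 P2 => [_ _ +] [_ _ +].
      have [Z1|nZ1] := pselect (Z p.1); last first.
        by move=> _ _; split; split=> -[Zp _]; case: nZ1 => //; exact/ZZ.
      have Z2 : Z p.2 by apply/ZZ.
      (* At each endpoint [c1 + c2 = 1], so the four values add up to 2, while each cover
         contributes at least 1. Hence [c1 p.1 + c1 p.2 = 1]: one end is below 1/2 exactly when the
         other is above. *)
      by rewrite !fZ// => c1E c2E; split; split=> -[_ /= c1p]; split => //=; lra.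
  have nAB' : {ae nu, forall x, ~ (A' `|` B') x}.
    have [mA' mB' _ _] := mAB'.
    (* Both [A'] and [B'] lie in [Z], so removing the union of [A] and [B] loses nothing. *)
    exists ((A' `|` B') `\` (A `|` B)); split.
    - by apply: measurableD; exact: measurableU.
    - exact: ABmax.
    - by move=> x /= /contrapT ABx; split=> // nZ; case: ABx => -[].
  suff cc : {ae nu, forall x, c1 x = c x /\ c2 x = c x}.
    by split; apply: filterS cc => x [].
  apply: filterS2 aeP nAB' => x [c1x c2x fx] nABx; rewrite cf.
  (* The values 0 and 1 are averages of two numbers of [0,1] only trivially; on [Z], [c1 x = 2^-1]
     forces [c2 x = 2^-1]. *)
  have [Ax|Bx|Zx] := cases x.
  - by move: fx; rewrite fA//; split; lra.
  - by move: fx; rewrite fB//; split; lra.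
  - move: fx; rewrite fZ//.
    have [c1lt|c1gt|->] := ltgtP (c1 x) 2^-1; last by split; lra.
      by case: nABx; left.
    by case: nABx; right.
have nZ : {ae nu, forall x, ~ Z x}.
  by apply: filterS cZ => x + Zx; rewrite cf fZ// => -[] E; clear -E; lra.
have W0 : {ae (nu \x nu)%E, forall p, W p = 0 \/
    [/\ A p.1 <-> B p.2, B p.1 <-> A p.2, ~ Z p.1 & ~ Z p.2]}.
  apply: filterS2 ABW (ae_prod nZ) => p ABp [nZ1 nZ2].
  have /andP[W0 _] := W01 p.
  have [Wp|Wp] := ltP 0 (W p); last by left; lra.
  by right; have [? ?] := ABp Wp.
exists A, (B `|` Z); split.
- by split=> //; exact: measurableU.
- by rewrite setUA setUv.
- by rewrite setIUr AB0 set0U /Z setCU setIA setICr set0I.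
(* If [W p] is not 0, the second endpoint would lie in both [A] and [B]. The other class is
   symmetric once the null set [Z] is discarded. *)
- apply: filterS W0 => p [//|[AB BA _ _]] [A1 A2].
  by case: (AnB p.2) => //; apply/AB.
- apply: filterS W0 => p [//|[AB BA nZ1 nZ2]] [[B1|//] [B2|//]].
  by case: (AnB p.2) => //; apply/BA.
Unshelve. all: by end_near.
Qed.
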